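(* Let $\mathcal{G}$ be the set of partitions $\lambda=(\lambda_1>\lambda_2>\cdots>\lambda_\ell)$ into distinct positive parts (empty partition included) such that $\lambda_{2i}-\lambda_{2i+1}$ is even whenever $2i+1\le\ell$, and, if $\ell$ is even, the smallest part $\lambda_\ell$ is even. Let $a(\lambda)=\lambda_1-\lambda_2+\lambda_3-\lambda_4+\cdots$ be the alternating sum of $\lambda$ and $|\lambda|$ the sum of its parts. Then $$\sum_{\lambda\in\mathcal{G}}z^{a(\lambda)}q^{|\lambda|}=\sum_{n=0}^{\infty}\frac{z^{n}q^{3n^2-2n}}{(zq;q^2)_n(q^4;q^4)_{n}}.$$
   Context: $(a;q)_n=\prod_{i=0}^{n-1}(1-aq^i)$; $|q|<1$ or formal power series. *)

(* Defs.v *)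
From HB Require Import structures.
From mathcomp Require Import all_boot all_order all_algebra.
From mathcomp Require Import boolp.

Set Implicit Arguments.
Unset Strict Implicit.
Unset Printing Implicit Defensive.

Import Order.TTheory GRing.Theory Num.Theory.
Local Open Scope ring_scope.

(* Formal power series in one variable over R.  A record rather than a bare
   function type, so that the product is the Cauchy product and not the
   pointwise one. *)
Record fps (R : Type) := FPS { fcoef : nat -> R }.

Lemma fpsP (R : Type) (f g : fps R) : fcoef f =1 fcoef g -> f = g.
Proof. by case: f g => [f] [g] /= /funext ->. Qed.

HB.instance Definition _ (R : Type) := gen_eqMixin (fps R).
HB.instance Definition _ (R : Type) := gen_choiceMixin (fps R).

Section FpsRing.
Variable R : comNzRingType.
Implicit Types f g h : fps R.

Definition fps_const (c : R) : fps R := FPS (fun n => if n == 0%N then c else 0).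
Definition fps_X : fps R := FPS (fun n => (n == 1%N)%:R).

Definition fps_zero : fps R := FPS (fun=> 0).
Definition fps_opp f : fps R := FPS (fun n => - fcoef f n).
Definition fps_add f g : fps R := FPS (fun n => fcoef f n + fcoef g n).
Definition fps_mul f g : fps R :=
  FPS (fun n => \sum_(i < n.+1) fcoef f i * fcoef g (n - i)).

Fact fps_addA : associative fps_add.
Proof. by move=> f g h; apply: fpsP => n /=; rewrite addrA. Qed.
Fact fps_addC : commutative fps_add.
Proof. by move=> f g; apply: fpsP => n /=; rewrite addrC. Qed.
Fact fps_add0 : left_id fps_zero fps_add.
Proof. by move=> f; apply: fpsP => n /=; rewrite add0r. Qed.
Fact fps_addN : left_inverse fps_zero fps_opp fps_add.
Proof. by move=> f; apply: fpsP => n /=; rewrite addNr. Qed.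

HB.instance Definition _ :=
  GRing.isZmodule.Build (fps R) fps_addA fps_addC fps_add0 fps_addN.

Definition fps_trunc (N : nat) f : {poly R} := \poly_(i < N) fcoef f i.

Lemma fcoef_mulE N f g n : (n < N)%N ->
  fcoef (fps_mul f g) n = (fps_trunc N f * fps_trunc N g)`_n.
Proof.
move=> nN; rewrite coefM /=; apply: eq_bigr => i _; rewrite !coef_poly.
have le_in : (i <= n)%N by rewrite -ltnS.
by rewrite (leq_ltn_trans le_in nN) (leq_ltn_trans (leq_subr i n) nN).
Qed.

Fact fps_mulC : commutative fps_mul.
Proof. by move=> f g; apply: fpsP => n; rewrite !(@fcoef_mulE n.+1) // mulrC. Qed.

Fact fps_mulA : associative fps_mul.
Proof.
move=> f g h; apply: fpsP => n; rewrite !(@fcoef_mulE n.+1) //.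
have coef_trunc (u v : {poly R}) (w : fps R) :
    (forall i, (i <= n)%N -> fcoef w i = (u * v)`_i) ->
  forall i, (i <= n)%N -> (fps_trunc n.+1 w)`_i = (u * v)`_i.
  by move=> uvw i le_in; rewrite coef_poly ltnS le_in uvw.
transitivity ((fps_trunc n.+1 f * (fps_trunc n.+1 g * fps_trunc n.+1 h))`_n).
  rewrite [LHS]coefM [RHS]coefM; apply: eq_bigr => i _; congr (_ * _).
  by apply: coef_trunc (leq_subr _ _) => j le_jn; apply: fcoef_mulE.
rewrite mulrA [LHS]coefM [RHS]coefM; apply: eq_bigr => i _; congr (_ * _).
apply/esym; apply: coef_trunc; last by rewrite -ltnS.
by move=> j le_jn; apply: fcoef_mulE.
Qed.

Fact fps_mul1 : left_id (fps_const 1) fps_mul.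
Proof.
move=> f; apply: fpsP => n /=; rewrite big_ord_recl /= mul1r subn0 big1 ?addr0 //.
by move=> i _; rewrite mul0r.
Qed.

Fact fps_mulDl : left_distributive fps_mul fps_add.
Proof.
move=> f g h; apply: fpsP => n /=; rewrite -big_split /=.
by apply: eq_bigr => i _; rewrite mulrDl.
Qed.

Fact fps_one_neq0 : fps_const 1 != 0.
Proof.
apply/eqP => /(congr1 (fun f => fcoef f 0)) /= /eqP.
by rewrite oner_eq0.
Qed.

HB.instance Definition _ := GRing.Zmodule_isComNzRing.Build (fps R)
  fps_mulA fps_mulC fps_mul1 fps_mulDl fps_one_neq0.

Definition fps_unit : {pred fps R} := fun f => `[< exists g, g * f = 1 >].

(* The multiplicative inverse of an invertible series; by the library's
   convention for unit rings a non-invertible one is sent to itself. *)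
Definition fps_inv f : fps R :=
  if pselect (exists g, g * f = 1) is left ex then projT1 (cid ex) else f.

Fact fps_mulVf : {in fps_unit, left_inverse 1 fps_inv *%R}.
Proof.
move=> f /asboolP f_unit; rewrite /fps_inv.
by case: pselect => // ex; case: (cid ex).
Qed.
Fact fps_unitPl f g : g * f = 1 -> fps_unit f.
Proof. by move=> gf1; apply/asboolP; exists g. Qed.
Fact fps_inv_out : {in [predC fps_unit], fps_inv =1 id}.
Proof.
move=> f /negP f_nunit; rewrite /fps_inv; case: pselect => // ex.
by case: f_nunit; apply/asboolP.
Qed.

HB.instance Definition _ := GRing.ComNzRing_hasMulInverse.Build (fps R)
  fps_mulVf fps_unitPl fps_inv_out.

Lemma fcoef0 n : fcoef (0 : fps R) n = 0. Proof. by []. Qed.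
Lemma fcoef1 n : fcoef (1 : fps R) n = (n == 0%N)%:R.
Proof. by rewrite /=; case: eqP. Qed.
Lemma fcoefD f g n : fcoef (f + g) n = fcoef f n + fcoef g n. Proof. by []. Qed.
Lemma fcoefN f n : fcoef (- f) n = - fcoef f n. Proof. by []. Qed.
Lemma fcoefM f g n :
  fcoef (f * g) n = \sum_(i < n.+1) fcoef f i * fcoef g (n - i).
Proof. by []. Qed.

Lemma fcoef_exp_lt f k n : fcoef f 0 = 0 -> (n < k)%N -> fcoef (f ^+ k) n = 0.
Proof.
move=> f0; elim: k n => // k IHk n lt_nk; rewrite exprS fcoefM big1 // => i _.
have [->|i_gt0] := posnP i; first by rewrite f0 mul0r.
have le_in : (i <= n)%N by rewrite -ltnS.
rewrite IHk ?mulr0 // ltn_subLR // (leq_trans lt_nk) //.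
by rewrite -add1n leq_add2r.
Qed.

Lemma fps_unit_coef0 f : fcoef f 0 = 1 -> f \is a GRing.unit.
Proof.
move=> f0; pose u := 1 - f.
have u0 : fcoef u 0 = 0 by rewrite fcoefD fcoefN f0 subrr.
have geom N : f * \sum_(k < N) u ^+ k = 1 - u ^+ N.
  have fE : - (u - 1) = f by rewrite opprB subKr.
  by rewrite -[RHS]opprB subrX1 -mulNr fE.
pose g := FPS (fun n => fcoef (\sum_(k < n.+1) u ^+ k) n).
have g_trunc N n : (n < N)%N -> fcoef g n = fcoef (\sum_(k < N) u ^+ k) n.
  move=> lt_nN; rewrite -(subnKC lt_nN) big_split_ord fcoefD /=.
  have fcoef_sum (I : finType) (F : I -> fps R) :
      fcoef (\sum_i F i) n = \sum_i fcoef (F i) n.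
    by apply: (big_morph (fun h => fcoef h n)).
  rewrite [X in _ = _ + X]fcoef_sum [X in _ = _ + X]big1 ?addr0 // => i _.
  by rewrite fcoef_exp_lt // ltnS leq_addr.
apply/asboolP; exists g; rewrite mulrC; apply: fpsP => n.
rewrite fcoefM (eq_bigr (fun i : 'I_n.+1 =>
  fcoef f i * fcoef (\sum_(k < n.+1) u ^+ k) (n - i))); last first.
  by move=> i _; rewrite (@g_trunc n.+1) // ltnS leq_subr.
by rewrite -fcoefM geom fcoefD fcoefN fcoef_exp_lt // subr0.
Qed.

(* Convergence is coefficientwise: each coefficient of the partial sums is
   eventually constant along the finite subsets of the index type. *)
Definition fps_has_sum (I : eqType) (F : I -> fps R) (S : fps R) : Prop :=
  forall n, exists J0 : seq I, forall J : seq I,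
    uniq J -> {subset J0 <= J} -> fcoef (\sum_(i <- J) F i) n = fcoef S n.

Lemma fps_has_sum_unique (I : eqType) (F : I -> fps R) S T :
  fps_has_sum F S -> fps_has_sum F T -> S = T.
Proof.
move=> FS FT; apply: fpsP => n; have [J1 J1P] := FS n; have [J2 J2P] := FT n.
pose J := undup (J1 ++ J2).
have uJ : uniq J by rewrite undup_uniq.
rewrite -(J1P J) ?(J2P J) // => i iJ; rewrite mem_undup mem_cat iJ ?orbT //.
Qed.

End FpsRing.

Definition qpoch (A : comNzRingType) (a q : A) (n : nat) : A :=
  \prod_(i < n) (1 - a * q ^+ i).

Lemma qpoch_unit (R : comNzRingType) (a q : fps R) (n : nat) :
  fcoef a 0 = 0 -> qpoch a q n \is a GRing.unit.
Proof.
move=> a0; apply: rpred_prod => i _; apply: fps_unit_coef0.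
by rewrite fcoefD fcoefN fcoefM big_ord1 a0 mul0r subr0.
Qed.

(* The series live in Z[z][[q]]. *)
Definition zvar : fps {poly int} := fps_const 'X.
Definition qvar : fps {poly int} := fps_X {poly int}.

(* Partitions are lists of parts; part l j is the j-th part, counted from 1. *)
Definition part (l : seq nat) (j : nat) : nat := nth 0%N l j.-1.

Definition distinct_partition (l : seq nat) : bool :=
  sorted gtn l && all (leq 1) l.

Definition in_G (l : seq nat) : bool :=
  [&& distinct_partition l,
      all (fun i => (i.*2.+1 <= size l)%N ==>
                    ~~ odd (part l i.*2 - part l i.*2.+1)) (iota 1 (size l))
    & ~~ odd (size l) ==> ~~ odd (last 0%N l)].

Definition partG := {l : seq nat | in_G l}.

Definition altsum (l : seq nat) : int :=
  \sum_(1 <= j < (size l).+1) (-1) ^+ j.-1 * (part l j)%:Z.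

(* For partitions into distinct parts the alternating sum is nonnegative, so it
   is recovered from its absolute value. *)
Lemma altsum_ge0 l : distinct_partition l -> 0 <= altsum l.
Proof.
have altsum_cons x s : altsum (x :: s) = x%:Z - altsum s.
  rewrite /altsum /= big_nat_recl //= mul1r -sumrN; congr (_ + _).
  apply: eq_big_nat => -[//|j] _.
  by rewrite /part /= exprS mulN1r mulNr.
have altsum0 : altsum [::] = 0 by rewrite /altsum big_geq.
suff H x s : path gtn x s -> 0 <= altsum (x :: s) <= x%:Z.
  by case: l => [|x s] /andP[+ _] /=; rewrite ?altsum0 // => /H/andP[].
elim: s x => [|y s IHs] x /=; first by rewrite altsum_cons altsum0 subr0 lexx.
case/andP => lt_yx /IHs /andP[ge0 le_y]; rewrite altsum_cons.
rewrite subr_ge0 (le_trans le_y) ?lez_nat ?(ltnW lt_yx) //=.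
by rewrite gerBl.
Qed.

(* Main.v *)
Require Import Defs.
From mathcomp Require Import all_boot all_order all_algebra.
From mathcomp Require Import boolp ring zify.

Set Implicit Arguments.
Unset Strict Implicit.
Unset Printing Implicit Defensive.

Import Order.TTheory GRing.Theory Num.Theory.
Local Open Scope ring_scope.

(** Group the parts of a partition of G into n pairs, the last one completed by
    a zero part if the length is odd.  The partition is determined by the
    differences: inside the i-th pair the difference is an arbitrary d >= 1, and
    between the i-th pair and the next one (or zero, after the last pair) it is
    2e with e >= 1, except that e = 0 is allowed after the last pair.  Raising
    the first 2i-1 parts by d multiplies the monomial by (z q^(2i-1))^d, raising
    the first 2i parts by 2e multiplies it by q^(4ie).  The partitions with n
    pairs thus contribute a product of 2n geometric series, which is the n-th
    summand on the right-hand side. *)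

(** * Summable families of power series *)

Section Summation.
Variable R : comNzRingType.
Implicit Types f g h : fps R.

(** Congruence modulo the power [N.+1] of the variable. *)
Definition eq_upto (N : nat) f g := forall n, (n <= N)%N -> fcoef f n = fcoef g n.

Lemma eq_upto_sym N f g : eq_upto N f g -> eq_upto N g f.
Proof. by move=> fg n /fg. Qed.

Lemma eq_upto_trans N f g h : eq_upto N f g -> eq_upto N g h -> eq_upto N f h.
Proof. by move=> fg gh n nN; rewrite fg ?gh. Qed.

Lemma eq_uptoD N f f' g g' :
  eq_upto N f f' -> eq_upto N g g' -> eq_upto N (f + g) (f' + g').
Proof. by move=> ff gg n nN; rewrite !fcoefD ff ?gg. Qed.

Lemma eq_uptoM N f f' g g' :
  eq_upto N f f' -> eq_upto N g g' -> eq_upto N (f * g) (f' * g').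
Proof.
move=> ff gg n nN; rewrite !fcoefM; apply: eq_bigr => i _.
have le_in : (i <= n)%N by rewrite -ltnS.
by rewrite ff ?gg // (leq_trans _ nN) // leq_subr.
Qed.

Lemma eq_upto_sum N (I : eqType) (r : seq I) (F G : I -> fps R) :
  (forall i, i \in r -> eq_upto N (F i) (G i)) ->
  eq_upto N (\sum_(i <- r) F i) (\sum_(i <- r) G i).
Proof.
move=> FG; rewrite big_seq [X in eq_upto N _ X]big_seq.
by apply: (big_ind2 (eq_upto N)) => // *; apply: eq_uptoD.
Qed.

Lemma eq_upto_exp0 N f k : fcoef f 0 = 0 -> (N < k)%N -> eq_upto N (f ^+ k) 0.
Proof. by move=> f0 Nk n nN; rewrite fcoef_exp_lt ?fcoef0 // (leq_ltn_trans nN). Qed.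

(* Unlike in [fps_has_sum], the finite set depends only on a bound for the
   degree and contains every index that contributes; this is the form that is
   stable under products. *)
Definition has_sum (I : eqType) (F : I -> fps R) (S : fps R) :=
  forall N, exists J0 : seq I,
    (forall i, i \notin J0 -> eq_upto N (F i) 0) /\
    (forall J, uniq J -> {subset J0 <= J} -> eq_upto N (\sum_(i <- J) F i) S).

Lemma has_sum_fps (I : eqType) (F : I -> fps R) S :
  has_sum F S -> fps_has_sum F S.
Proof. by move=> FS n; have [J0 [_ J0P]] := FS n; exists J0 => J uJ /J0P; apply. Qed.

(** One finite set per bound suffices: enlarging it only adds terms that vanish up to degree [N]. *)
Lemma has_sumI (I : eqType) (F : I -> fps R) S :
  (forall N, exists J0 : seq I, [/\ uniq J0,
     forall i, i \notin J0 -> eq_upto N (F i) 0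
     & eq_upto N (\sum_(i <- J0) F i) S]) -> has_sum F S.
Proof.
move=> FS N; have [J0 [uJ0 F0 sumJ0]] := FS N; exists J0; split=> // J uJ J0J.
apply: eq_upto_trans sumJ0; rewrite (bigID (mem J0)) /=.
have /permPl eqJ0 : perm_eq [seq i <- J | i \in J0] J0.
  apply: uniq_perm; rewrite ?filter_uniq // => i.
  by rewrite mem_filter andb_idr // => /J0J.
rewrite -[X in eq_upto N _ X]addr0; apply: eq_uptoD.
  by rewrite -big_filter (perm_big J0) //; apply/permPl.
rewrite -big_filter => n nN.
have -> // := @eq_upto_sum N _ [seq i <- J | i \notin J0] F (fun=> 0).
  by rewrite big1.
by move=> i; rewrite mem_filter => /andP[/F0].
Qed.

Lemma has_sumE (I : eqType) (F : I -> fps R) S N : has_sum F S ->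
  exists J0 : seq I, [/\ uniq J0,
     forall i, i \notin J0 -> eq_upto N (F i) 0
     & eq_upto N (\sum_(i <- J0) F i) S].
Proof.
move=> /(_ N)[J0 [F0 J0P]]; exists (undup J0).
split; first exact: undup_uniq.
  by move=> i; rewrite mem_undup; apply: F0.
by apply: J0P; rewrite ?undup_uniq // => i; rewrite mem_undup.
Qed.

Lemma eq_has_sum (I : eqType) (F G : I -> fps R) S :
  F =1 G -> has_sum F S -> has_sum G S.
Proof.
move=> FG FS N; have [J0 [F0 J0P]] := FS N; exists J0; split.
  by move=> i; rewrite -FG; apply: F0.
by move=> J uJ /J0P-/(_ uJ); rewrite (eq_bigr G).
Qed.

Lemma has_sum_geom f : fcoef f 0 = 0 -> has_sum (fun d => f ^+ d) (1 - f)^-1.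
Proof.
move=> f0; apply: has_sumI => N; exists (iota 0 N.+1); split.
- exact: iota_uniq.
- by move=> d; rewrite mem_iota add0n -leqNgt /=; apply: eq_upto_exp0.
have uf : 1 - f \is a GRing.unit.
  by apply: fps_unit_coef0; rewrite fcoefD fcoefN f0 subr0.
(* After multiplication by [1 - f] the partial sum telescopes to [1 - f ^+ N.+1]. *)
rewrite -[X in eq_upto N X](mulKr uf) -[X in eq_upto N _ X]mulr1.
apply: eq_uptoM => //; rewrite -[iota 0 _]/(index_iota 0 N.+1) big_mkord.
rewrite -[1 - f]opprB mulNr -subrX1 opprB -[X in eq_upto N _ X]subr0.
by move=> n nN; rewrite !fcoefD !fcoefN fcoef_exp_lt ?fcoef0.
Qed.

(** Outside the rectangle [I0 * J0] one factor vanishes up to degree [N]; on it the double sum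
    factors. *)
Lemma has_sumM (I J : eqType) (F : I -> fps R) (G : J -> fps R) S T :
  has_sum F S -> has_sum G T -> has_sum (fun ij => F ij.1 * G ij.2) (S * T).
Proof.
move=> FS GT; apply: has_sumI => N.
have [I0 [uI0 F0 sumF]] := has_sumE N FS; have [J0 [uJ0 G0 sumG]] := has_sumE N GT.
exists [seq (i, j) | i <- I0, j <- J0]; split.
- by apply: allpairs_uniq => // -[i j] [i' j'].
- move=> [i j] /= ijIJ; have : (i \notin I0) || (j \notin J0).
    by rewrite -negb_and; apply: contra ijIJ => /andP[iI jJ]; apply: allpairs_f.
  case/orP => [/F0 Fi|/G0 Gj]; [rewrite -(mul0r (G j))|rewrite -(mulr0 (F i))];
    exact: eq_uptoM.
rewrite big_allpairs_dep /= -big_distrlr; exact: eq_uptoM.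
Qed.

Lemma has_sumZ (I : eqType) (F : I -> fps R) S c :
  has_sum F S -> has_sum (fun i => c * F i) (c * S).
Proof.
move=> FS; apply: has_sumI => N; have [J0 [uJ0 F0 sumF]] := has_sumE N FS.
exists J0; split=> // [i /F0 Fi|]; last by rewrite -big_distrr; apply: eq_uptoM.
by rewrite -(mulr0 c); apply: eq_uptoM.
Qed.

Lemma has_sum_inj (I J : eqType) (g : I -> J) (F : J -> fps R) S :
  injective g -> (forall j, (exists i, g i = j) \/ F j = 0) ->
  has_sum (F \o g) S -> has_sum F S.
Proof.
move=> g_inj gF FS; apply: has_sumI => N; have [I0 [uI0 F0 sumF]] := has_sumE N FS.
exists (map g I0); split; rewrite ?map_inj_uniq ?big_map // => j.
by case: (gF j) => [[i <-]|-> //]; rewrite mem_map //; apply: F0.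
Qed.

(** Up to degree [N] only the finitely many fibres over [n <= N] contribute, so summing fibre by
    fibre and summing at once are the same finite computation. *)
Lemma has_sum_fibres (I : eqType) (phi : I -> nat) (F : I -> fps R) (T : nat -> fps R) :
    (forall N i, (N < phi i)%N -> eq_upto N (F i) 0) ->
    (forall n, has_sum (fun i => if phi i == n then F i else 0) (T n)) ->
  exists S, has_sum F S /\ has_sum T S.
Proof.
move=> F_phi FT.
have T_large N n : (N < n)%N -> eq_upto N (T n) 0.
  move=> Nn; have [J [_ _ /eq_upto_sym sumJ]] := has_sumE N (FT n).
  apply: (eq_upto_trans sumJ).
  apply: (@eq_upto_trans _ _ (\sum_(i <- J) 0)); last by rewrite big1.
  by apply: eq_upto_sum => i _; case: eqP => // in_n; apply: F_phi; rewrite in_n.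
(* Diagonal choice: the terms [T n] with [n > N] do not reach degree [N]. *)
pose S := FPS (fun N => fcoef (\sum_(n < N.+1) T n) N).
have sumT N : eq_upto N (\sum_(n < N.+1) T n) S.
  move=> n nN /=; rewrite -!(big_mkord xpredT) (big_cat_nat (n := n.+1)) //.
  rewrite fcoefD -[RHS]addr0; congr (_ + _).
  rewrite /index_iota (@eq_upto_sum n _ _ T (fun=> 0)) ?big1 ?fcoef0 //.
  by move=> m; rewrite mem_iota => /andP[/T_large].
exists S; split; apply: has_sumI => N.
  have /choice[J JP] n := FT n N.
  exists (undup (flatten [seq J n | n <- iota 0 N.+1])); set K := undup _.
  have JK n : (n <= N)%N -> {subset J n <= K}.
    move=> nN i iJ; rewrite mem_undup; apply/flatten_mapP.
    by exists n; rewrite ?mem_iota.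
  split; first exact: undup_uniq.
    move=> i iK; have [/F_phi//|iN] := ltnP N (phi i).
    have [/(_ i) + _] := JP (phi i); rewrite eqxx; apply.
    by apply: contra iK; apply: JK.
  apply: eq_upto_trans (sumT N).
  (* Each [F i] is spread over the fibres [n <= N], so that the two sums can be exchanged. *)
  apply: (@eq_upto_trans _ _
    (\sum_(i <- K) \sum_(n < N.+1) if phi i == n then F i else 0)).
    apply: eq_upto_sum => i _; have [Ni|iN] := ltnP N (phi i).
      by rewrite big1 => [|n _]; [apply: F_phi|case: eqP (ltn_ord n) => //; lia].
    rewrite -big_mkcond (big_pred1 (Ordinal (iN : (phi i < N.+1)%N))) //.
  rewrite exchange_big; apply: eq_upto_sum => n _.
  have [_] := JP n; apply; first exact: undup_uniq.
  by apply: JK; rewrite -ltnS.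
exists (iota 0 N.+1); split; first exact: iota_uniq.
  by move=> n; rewrite mem_iota add0n -leqNgt /=; apply: T_large.
rewrite -[iota 0 _]/(index_iota 0 N.+1) big_mkord; exact: sumT.
Qed.

End Summation.

(** * Coding the partitions of G by differences *)

(* The i-th entry (d, e) encodes the differences d + 1 inside the i-th pair of
   parts and 2 (e + 1) after it, or 2 e after the last pair. *)
Fixpoint build (p : seq (nat * nat)) : seq nat :=
  if p is (d, e) :: p' then
    let r := build p' in
    let y := (head 0%N r + 2 * (e + (p' != [::])))%N in
    (y + d.+1)%N :: (if y == 0%N then [::] else y :: r)
  else [::].

(** The default in [head 0 r] is a zero part closing a partition of even length: evenness of the
    smallest part becomes one more even difference, and its positivity one more strict descent. *)
Fixpoint G_rec (l : seq nat) : bool :=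
  match l with
  | [::] => true
  | [:: x] => (0 < x)%N
  | x :: y :: r => [&& y < x, head 0%N r < y, ~~ odd (y - head 0%N r) & G_rec r]%N
  end.

Lemma in_G_cons2 x y r :
  in_G (x :: y :: r) =
    [&& y < x, head 0 r < y, ~~ odd (y - head 0 r) & in_G r]%N.
Proof.
pose Q (l : seq nat) i := (i.*2.+2 < size l)%N ==>
  ~~ odd (nth 0%N l i.*2.+1 - nth 0%N l i.*2.+2).
have QE l : all (fun i => (i.*2.+1 <= size l)%N ==>
    ~~ odd (part l i.*2 - part l i.*2.+1)) (iota 1 (size l)) =
    all (Q l) (iota 0 (size l)).
  by rewrite -[1%N]addn0 iotaDl all_map; apply: eq_all => i.
have QS : all (Q (x :: y :: r)) (iota 0 (size r).+2) =
    Q (x :: y :: r) 0%N && all (Q r) (iota 0 (size r)).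
  rewrite -[LHS]/(Q _ 0%N && all (Q _) (iota 1 (size r).+1)).
  rewrite -[1%N]addn0 iotaDl all_map; congr (_ && _).
  (* Removing two parts shifts the index by one; the one index in excess lies beyond the length, so
     its condition is vacuous. *)
  rewrite -[(size r).+1]addn1 iotaD all_cat /= andbT add0n.
  rewrite [X in _ && X](_ : _ = true) ?andbT; last by rewrite /Q /=; lia.
  by apply: eq_all.
rewrite /in_G !QE QS /distinct_partition; case: r {QE QS} => [|u s] /=.
  by rewrite /Q /= subn0; lia.
move: (all (Q _) _) => b; rewrite /Q /= !negbK.
by move: (path _ _ _) (all _ s) (odd (size s)) (odd (last u s)) => [] [] [] [] /=; lia.
Qed.

Lemma in_GE l : in_G l = G_rec l.
Proof.
have [n] := ubnP (size l); elim: n l => // n IHn [|x [|y r]] //=.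
  by rewrite /in_G /distinct_partition /= !andbT.
by move=> ltrn; rewrite in_G_cons2 IHn //; lia.
Qed.

(** Hence the second part of a pair can be zero only in the last pair. *)
Lemma head_build_gt0 p : (0 < head 0%N (build p))%N = (p != [::]).
Proof. by case: p => [|[d e] p] //=; rewrite addnS. Qed.

Lemma G_rec_build p : G_rec (build p).
Proof.
elim: p => [|[d e] p IHp] //=; have := head_build_gt0 p.
case: (_ =P 0%N) => [_ _|y0 h] /=; first by rewrite addnS.
rewrite IHp andbT.
by move: (head 0%N _) (p != [::]) h y0 => u [] /=; lia.
Qed.

Lemma build_surj l : G_rec l -> exists p, build p = l.
Proof.
have [n] := ubnP (size l); elim: n l => // n IHn [|x [|y r]] //= ltrn.
- by exists [::].
- by move=> x0; exists [:: (x.-1, 0%N)]; congr cons; rewrite /= addnS; lia.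
case/and4P=> yx ry yr Gr; have [|p pr] := IHn r _ Gr; first lia.
have := head_build_gt0 p; rewrite pr => hp.
(* Half the gap after the pair is [e + 1] if another pair follows and [e] otherwise. *)
exists (((x - y.+1)%N, ((y - head 0%N r)./2 - (p != [::]))%N) :: p); rewrite /= pr.
have -> : (head 0%N r + 2 * ((y - head 0%N r)./2 - (p != [::]) + (p != [::])) = y)%N.
  by move: hp yr ry; case: (p != [::]) => /=; lia.
have -> : (y == 0)%N = false by lia.
by congr cons; lia.
Qed.

(** The first part minus the second, zero if absent, gives [d]; the remaining parts give the tail by
    induction, and then the gap gives [e]. *)
Lemma build_inj : injective build.
Proof.
elim=> [|[d e] p IHp] [|[d' e'] p'] //= [].
have := head_build_gt0 p; have := head_build_gt0 p'.
case: (_ =P 0%N) => [y0|/eqP y0]; case: (_ =P 0%N) => [y0'|/eqP y0'] //.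
  move=> hp' hp hd _; have p0 : p = [::] by case: p y0 {IHp hp hd} => //= *; lia.
  have p0' : p' = [::] by case: p' y0' {hp' hd} => //= *; lia.
  by subst => /=; move: y0 y0' hd => /= *; congr [:: (_, _)]; lia.
move=> _ _ hd [hy /IHp pp']; subst p'.
by congr ((_, _) :: _); lia.
Qed.

(** * Size and alternating sum in terms of the code *)

(* The size contributed by [p] when it is preceded by [k] pairs, each part of
   which is raised by every increase of the largest part of [build p]. *)
Fixpoint weight (k : nat) (p : seq (nat * nat)) : nat :=
  if p is (d, e) :: p' then
    (k.*2.+1 * d.+1 + 4 * k.+1 * (e + (p' != [::])) + weight k.+1 p')%N
  else 0%N.

Lemma weight_build k p : (sumn (build p) + k.*2 * head 0%N (build p) = weight k p)%N.
Proof.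
elim: p k => [|[d e] p IHp] k //=; first by rewrite muln0.
rewrite -IHp; set y := (head 0%N _ + _)%N.
(* If [y] is zero then [p] is empty, so the omitted parts sum to zero. *)
have -> : sumn (if y == 0%N then [::] else y :: build p) = (y + sumn (build p))%N.
  by case: (_ =P 0%N) => // y0; case: p @y y0 {IHp} => //= *; lia.
rewrite {}/y; nia.
Qed.

Lemma altsum_cons x s : altsum (x :: s) = x%:Z - altsum s.
Proof.
rewrite /altsum /= big_nat_recl //= mul1r -sumrN; congr (_ + _).
by apply: eq_big_nat => -[//|j] _; rewrite /part /= exprS mulN1r mulNr.
Qed.

(** Gaps between pairs cancel, and each pair contributes its inner difference [d.+1]. *)
Lemma altsum_build p : altsum (build p) = (sumn [seq de.1.+1 | de <- p])%:Z.
Proof.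
have altsum0 : altsum [::] = 0 by rewrite /altsum big_geq.
elim: p => [|[d e] p IHp] //=; rewrite altsum_cons.
case: (_ =P 0%N) => [y0|_]; last by rewrite altsum_cons IHp; lia.
by case: p y0 {IHp} => [|? ?] /= *; rewrite ?altsum0; lia.
Qed.

(** This bounds the number of pairs that matter up to a given degree. *)
Lemma size_weight k p : (size p <= weight k p)%N.
Proof. by elim: p k => [|[d e] p IHp] k //=; have := IHp k.+1; nia. Qed.

(** * Generating function for a fixed number of pairs *)

Definition pair_monomial (k : nat) (p : seq (nat * nat)) : fps {poly int} :=
  zvar ^+ sumn [seq de.1.+1 | de <- p] * qvar ^+ weight k p.

Lemma fcoef_qvarX n : (0 < n)%N -> fcoef (qvar ^+ n) 0 = 0.
Proof. by move=> n0; rewrite fcoef_exp_lt. Qed.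

Lemma fcoef_mulqX (f : fps {poly int}) n : (0 < n)%N -> fcoef (f * qvar ^+ n) 0 = 0.
Proof. by move=> n0; rewrite fcoefM big_ord1 subnn fcoef_qvarX ?mulr0. Qed.

Lemma unit_subXq (f : fps {poly int}) n : (0 < n)%N ->
  1 - f * qvar ^+ n \is a GRing.unit.
Proof.
by move=> n0; apply: fps_unit_coef0; rewrite fcoefD fcoefN fcoef_mulqX ?subr0.
Qed.

(** For [k = 0] this is the product of the two q-Pochhammer symbols; the shift [k] serves the
    induction. The factor [1 *] gives both kinds of factor the shape [1 - f * qvar ^+ n]. *)
Definition denom (k m : nat) : fps {poly int} :=
  \prod_(i < m) ((1 - zvar * qvar ^+ (k + i).*2.+1)
                 * (1 - 1 * qvar ^+ (4 * (k + i).+1))).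

Lemma denomS k m : denom k m.+1 =
  (1 - zvar * qvar ^+ k.*2.+1) * (1 - 1 * qvar ^+ (4 * k.+1)) * denom k.+1 m.
Proof.
rewrite /denom big_ord_recl addn0; congr (_ * _); apply: eq_bigr => i _.
by rewrite /bump /= addnCA addnA.
Qed.

(* For [m = 0] the truncated subtraction makes the exponent of [qvar] zero. *)
Lemma has_sum_pair_monomial k m :
  has_sum (fun p => if size p == m then pair_monomial k p else 0)
    (zvar ^+ m * qvar ^+ (3 * m ^ 2 + 6 * k * m - (2 * m + 4 * k)) / denom k m).
Proof.
elim: m k => [|m IHm] k.
  apply: has_sumI => N; exists [:: [::]]; split=> //; first by case.
  by rewrite big_seq1 /= /pair_monomial /denom big_ord0 muln0 divr1.
pose a := zvar * qvar ^+ k.*2.+1; pose b : fps {poly int} := 1 * qvar ^+ (4 * k.+1).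
have a0 : fcoef a 0 = 0 by apply: fcoef_mulqX.
have b0 : fcoef b 0 = 0 by apply: fcoef_mulqX.
have ua : 1 - a \is a GRing.unit by apply: unit_subXq.
have ub : 1 - b \is a GRing.unit by apply: unit_subXq.
have ud : denom k.+1 m \is a GRing.unit.
  by apply: rpred_prod => i _; rewrite unitrMl unit_subXq.
(* Prepending [(d, e)] gives geometric series in [a] and [b]; the constant accounts for the least
   inner difference 1 and, if a pair follows, the least gap 2. *)
have := has_sumZ (a * qvar ^+ (4 * k.+1 * (m != 0))%N)
  (has_sumM (has_sumM (has_sum_geom a0) (has_sum_geom b0)) (IHm k.+1)).
rewrite [X in has_sum _ X](_ : _ = zvar ^+ m.+1 *
    qvar ^+ (3 * m.+1 ^ 2 + 6 * k * m.+1 - (2 * m.+1 + 4 * k)) / denom k m.+1).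
  move=> sumS; apply: (@has_sum_inj _ _ _ (fun dep => dep.1 :: dep.2)).
  - by move=> [[d e] p] [[d' e'] p'] /= [-> -> ->].
  - by move=> [|de p]; [right|left; exists (de, p)].
  apply: eq_has_sum sumS => -[[d e] p] /=.
  rewrite eqSS; case: (size p =P m) => [<-|_]; last by rewrite !mulr0.
  rewrite /pair_monomial /= -size_eq0 /a /b mul1r !exprMn -!exprM.
  have -> : (k.*2.+1 * d.+1 + 4 * k.+1 * (e + (size p != 0)) + weight k.+1 p =
    k.*2.+1 + 4 * k.+1 * (size p != 0) + k.*2.+1 * d + 4 * k.+1 * e
      + weight k.+1 p)%N by nia.
  by rewrite !exprD [zvar ^+ d.+1]exprS; ring.
(* These exponents are least weights, attained when all [d] and [e] are zero. The case [m = 0] is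
   separate because there the subtraction truncates. *)
have -> : (3 * m.+1 ^ 2 + 6 * k * m.+1 - (2 * m.+1 + 4 * k) =
    k.*2.+1 + 4 * k.+1 * (m != 0) +
    (3 * m ^ 2 + 6 * k.+1 * m - (2 * m + 4 * k.+1)))%N.
  by case: m {IHm ud} => [|m] /=; rewrite -!mulnn; nia.
rewrite denomS -/a -/b !invrM ?unitrMl //; move: (denom _ _)^-1 (1 - a)^-1 (1 - b)^-1.
move: (4 * _ * _)%N (_ - _)%N => c E d' a' b'; rewrite !exprD [zvar ^+ m.+1]exprS /a.
ring.
Qed.

(** * Summation over the number of pairs *)

Definition partG_of (p : seq (nat * nat)) : partG :=
  exist _ (build p) (etrans (in_GE _) (G_rec_build p)).

Theorem theorem5p5 :
  exists S : fps {poly int},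
    fps_has_sum
      (fun l : partG => zvar ^+ `|altsum (val l)|%N * qvar ^+ sumn (val l)) S /\
    fps_has_sum
      (fun n : nat =>
         zvar ^+ n * qvar ^+ (3 * n ^ 2 - 2 * n)%N
           / (qpoch (zvar * qvar) (qvar ^+ 2) n
              * qpoch (qvar ^+ 4) (qvar ^+ 4) n)) S.
Proof.
have small N p : (N < size p)%N -> eq_upto N (pair_monomial 0 p) 0.
  move=> Np; rewrite -(mulr0 (zvar ^+ sumn [seq de.1.+1 | de <- p])).
  apply: eq_uptoM => //; apply: eq_upto_exp0 => //.
  exact: leq_trans (size_weight 0 p).
have [S [sumG sumT]] := has_sum_fibres small (has_sum_pair_monomial 0).
exists S; split; apply: has_sum_fps.
  apply: (@has_sum_inj _ _ _ partG_of).
  - by move=> p p' [/build_inj].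
  - case=> l Gl; left; have [|p pl] := @build_surj l; first by rewrite -in_GE.
    by exists p; apply: val_inj.
  apply: eq_has_sum sumG => p /=.
  by rewrite /pair_monomial altsum_build -weight_build addn0.
apply: eq_has_sum sumT => n; congr (_ * qvar ^+ _ / _); first by rewrite muln0; lia.
rewrite /qpoch -big_split; apply: eq_bigr => i _ /=.
by rewrite -!exprM mul1r -mulrA -!exprS -exprD mul2n mulnS.
Qed.
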